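(* Let $n\ge 1$, $t>0$, let $\Sigma\subset\{1,\dots,n\}^2$ be an index set satisfying the total support condition, let $\nu\in\mathbb{R}^{2n}$, and let $$x=\mathbb{T}^{-1}(\mathbf 1_\Sigma)\odot \exp(-t(c-M^\top \nu))\in\mathbb{R}^{n^2}$$ (an approximate optimal solution, constructed from matrix balancing, of the problem of minimizing $\langle c,x\rangle+t^{-1}\langle \mathbf 1_{n^2}, x\odot\log x-x\rangle$ subject to $Mx=\mathbf 1_{2n}$ and support of $\mathbb{T}(x)$ contained in $\Sigma$). Let $\mathcal N$ be the null space of $\mathrm{diag}(\mathbb{T}^{-1}(\mathbf 1_\Sigma))M^\top$ and let $P:\mathbb{R}^{2n}\to\mathbb{R}^{2n}$ be the orthogonal projection with kernel $\mathcal N$. Suppose that $\|P\nu\|_2\le\delta$ for some constant $\delta>0$, and that $\mathbb{T}(x)$ is nearly doubly stochastic, i.e. $\|Mx-\mathbf 1_{2n}\|_2\le \epsilon_{MB}$ for some $\epsilon_{MB}>0$. Then $$|\langle c,x\rangle-\langle \mathbf 1_{2n},\nu\rangle|\le \epsilon_{MB}\,\delta+(et)^{-1}|\Sigma|,$$ where $|\Sigma|$ is the cardinality of $\Sigma$ and $e$ is Euler's number.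
   Context: $\mathbf 1_m\in\mathbb{R}^m$ is the all-ones vector; $\odot$ is the entrywise product; $\exp$ and $\log$ act entrywise. $\mathbb{T}:\mathbb{R}^{n^2}\to\mathbb{R}^{n\times n}$ is the (bijective, linear) reshape operator, identifying vectors of length $n^2$ with $n\times n$ matrices. $M:\mathbb{R}^{n^2}\to\mathbb{R}^{2n}$ is the linear map $Mx=[\mathbb{T}(x)\mathbf 1_n;\ \mathbb{T}(x)^\top\mathbf 1_n]$ (row sums stacked over column sums), so for $\nu=[\nu^{(1)};\nu^{(2)}]$ with $\nu^{(1)},\nu^{(2)}\in\mathbb{R}^n$, $\mathbb{T}(M^\top\nu)=\nu^{(1)}\mathbf 1_n^\top+\mathbf 1_n{\nu^{(2)}}^\top$. The cost vector $c\in\mathbb{R}^{n^2}$ is given by $\mathbb{T}(c)_{i,j}=\|y_i-z_j\|^2$ for two point sets $\{y_i\}_{i=1}^n,\{z_j\}_{j=1}^n$ in $\mathbb{R}^d$. $\mathbf 1_\Sigma$ is the $n\times n$ indicator matrix whose $(i,j)$ entry is $1$ if $(i,j)\in\Sigma$ and $0$ otherwise. For a permutation $\sigma$ of $\{1,\dots,n\}$, the sequence $X_{1,\sigma(1)},\dots,X_{n,\sigma(n)}$ is a diagonal of an $n\times n$ matrix $X$. A nonnegative square matrix $X$ has total support if $X\ne0$ and every positive entry of $X$ lies on a diagonal all of whose entries are positive; an index set $\Sigma$ satisfies the total support condition if $\mathbf 1_\Sigma$ has total support. *)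

(* Defs.v *)
From HB Require Import structures.
From mathcomp Require Export all_boot all_order all_algebra perm.
From mathcomp Require Export reals sequences exp.

Set Implicit Arguments.
Unset Strict Implicit.
Unset Printing Implicit Defensive.

Import Order.TTheory GRing.Theory Num.Theory.
Local Open Scope ring_scope.

Section Vectors.
Variable R : realType.

Definition dotv m (u v : 'cV[R]_m) : R := \sum_i u i 0 * v i 0.

(* The MathComp-Analysis norm `|v| on matrices is the sup norm, hence this one. *)
Definition norm2 m (v : 'cV[R]_m) : R := Num.sqrt (dotv v v).

Definition ones m : 'cV[R]_m := const_mx 1.

Definition hadamard m p (A B : 'M[R]_(m, p)) : 'M[R]_(m, p) :=
  map2_mx *%R A B.

Definition in_null_space m p (A : 'M[R]_(m, p)) (v : 'cV[R]_p) : Prop :=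
  A *m v = 0.

(* P is an orthogonal projection (idempotent, with range orthogonal to its
   kernel) and its kernel is the set N; such a P is unique. *)
Definition orthogonal_projection_with_kernel m (P : 'M[R]_m)
    (N : 'cV[R]_m -> Prop) : Prop :=
  [/\ P *m P = P,
      forall u v : 'cV[R]_m, in_null_space P v -> dotv (P *m u) v = 0
    & forall v : 'cV[R]_m, in_null_space P v <-> N v].

End Vectors.

Section Balancing.
Variables (R : realType) (n : nat).

(* Row-major reshape: vec_mx and mxvec are mutually inverse and act on row
   vectors, whence the transpositions. *)
Definition reshape_mx (x : 'cV[R]_(n * n)) : 'M[R]_n := vec_mx x^T.

Definition unreshape_mx (X : 'M[R]_n) : 'cV[R]_(n * n) := (mxvec X)^T.

Lemma reshape_mxK : cancel reshape_mx unreshape_mx.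
Proof. by move=> x; rewrite /unreshape_mx vec_mxK trmxK. Qed.

Lemma unreshape_mxK : cancel unreshape_mx reshape_mx.
Proof. by move=> X; rewrite /reshape_mx trmxK mxvecK. Qed.

Definition marginals (x : 'cV[R]_(n * n)) : 'cV[R]_(n + n) :=
  col_mx (reshape_mx x *m ones R n) ((reshape_mx x)^T *m ones R n).

(* The matrix of marginals in the canonical bases. *)
Definition marginal_mx : 'M[R]_(n + n, n * n) :=
  \matrix_(i, j) marginals (delta_mx j 0) i 0.

Lemma marginals_is_linear : linear marginals.
Proof.
move=> a x y; rewrite /marginals /reshape_mx !linearP /=.
by rewrite !mulmxDl -!scalemxAl scale_col_mx add_col_mx.
Qed.

Lemma marginal_mxE (x : 'cV[R]_(n * n)) : marginal_mx *m x = marginals x.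
Proof.
pose f : {linear _ -> _} :=
  HB.pack marginals (GRing.isLinear.Build _ _ _ _ marginals marginals_is_linear).
rewrite -[marginals]/(f : _ -> _) [in RHS](matrix_sum_delta x) linear_sum /=.
apply/matrixP => i j; rewrite ord1 mxE summxE; apply: eq_bigr => k _.
by rewrite big_ord1 -[marginals]/(f : _ -> _) linearZ /= !mxE mulrC.
Qed.

Lemma reshape_tr_marginal_mx (nu1 nu2 : 'cV[R]_n) :
  reshape_mx (marginal_mx^T *m col_mx nu1 nu2)
  = nu1 *m (ones R n)^T + ones R n *m nu2^T.
Proof.
apply/matrixP => i j; pose E := delta_mx (mxvec_index i j) 0 : 'cV[R]_(n * n).
have dE a b : reshape_mx E a b = ((a == i) && (b == j))%:R.
  by rewrite /reshape_mx trmx_delta vec_mx_delta mxE.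
have ME k : marginal_mx^T (mxvec_index i j) k = marginals E k 0.
  by rewrite mxE [LHS]mxE.
have ML k : marginals E (lshift n k) 0 = (k == i)%:R.
  rewrite col_mxEu mxE (bigD1 j) //= big1 => [|l /negbTE lj].
    by rewrite dE eqxx andbT mxE mulr1 addr0.
  by rewrite dE lj andbF mul0r.
have MR k : marginals E (rshift n k) 0 = (k == j)%:R.
  rewrite col_mxEd mxE (bigD1 i) //= big1 => [|l /negbTE li].
    by rewrite mxE dE eqxx mxE mulr1 addr0.
  by rewrite mxE dE li mul0r.
rewrite /reshape_mx mxE [LHS]mxE [LHS]mxE big_split_ord /= [RHS]mxE.
congr (_ + _); rewrite [RHS]mxE big_ord1 !mxE ?mulr1 ?mul1r.
  rewrite (bigD1 i) //= big1 => [|k /negbTE ki].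
    by rewrite ME ML eqxx col_mxEu mul1r addr0.
  by rewrite ME ML ki mul0r.
rewrite (bigD1 j) //= big1 => [|k /negbTE kj].
  by rewrite ME MR eqxx col_mxEd mul1r addr0.
by rewrite ME MR kj mul0r.
Qed.

Definition indicator_mx (Sigma : {set 'I_n * 'I_n}) : 'M[R]_n :=
  \matrix_(i, j) ((i, j) \in Sigma)%:R.

Definition total_support (X : 'M[R]_n) : Prop :=
  [/\ forall i j, 0 <= X i j,
      X != 0
    & forall i j, 0 < X i j ->
        exists s : 'S_n, s i = j /\ forall k, 0 < X k (s k)].

Definition total_support_condition (Sigma : {set 'I_n * 'I_n}) : Prop :=
  total_support (indicator_mx Sigma).

Definition cost_vector d (y z : 'I_n -> 'cV[R]_d) : 'cV[R]_(n * n) :=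
  unreshape_mx (\matrix_(i, j) norm2 (y i - z j) ^+ 2).

End Balancing.

Arguments indicator_mx R {n} Sigma.
Arguments total_support_condition R {n} Sigma.
Arguments marginal_mx : clear implicits.

(* Main.v *)
(** With mu = P nu and r = M x - 1, total support gives <1, nu> = <1, mu>, and
    mu and nu induce the same x, so that
      <c, x> - <1, nu> = <mu, r> - t^-1 sum_Sigma x log x.
    The upper bound follows from Cauchy-Schwarz and - x log x <= 1/e.  For the
    lower bound, x log x <= 1/e fails for entries larger than 1 (which
    approximate balancing does not exclude), and one uses c >= 0: an entry
    x_ij > 1 makes r positive at row i and at column j, while
    log x_ij <= t (mu_i + mu_j).  The surplus x log x - 1/e <= 2 (x - 1) log x
    is thus dominated by 2 t sum_k max(0, mu_k r_k), which is exactly what is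
    gained in - <mu, r> = sum |mu_k r_k| - 2 sum max(0, mu_k r_k). *)

Require Import Defs.
From mathcomp Require Import ring lra.

Set Implicit Arguments.
Unset Strict Implicit.
Unset Printing Implicit Defensive.

Import Order.TTheory GRing.Theory Num.Theory.
Local Open Scope ring_scope.

(** * Euclidean inner product and Cauchy-Schwarz *)

Lemma dotv_ge0 (R : realType) m (v : 'cV[R]_m) : 0 <= dotv v v.
Proof. by apply: sumr_ge0 => i _; rewrite -expr2 sqr_ge0. Qed.

Lemma sqr_norm2 (R : realType) m (v : 'cV[R]_m) : norm2 v ^+ 2 = dotv v v.
Proof. exact/sqr_sqrtr/dotv_ge0. Qed.

Lemma dotvC (R : realType) m (u v : 'cV[R]_m) : dotv u v = dotv v u.
Proof. by apply: eq_bigr => i _; rewrite mulrC. Qed.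

Lemma dotvB (R : realType) m (u v w : 'cV[R]_m) :
  dotv u (v - w) = dotv u v - dotv u w.
Proof. by rewrite -sumrB; apply: eq_bigr => i _; rewrite !mxE mulrBr. Qed.

Lemma dotv_mulmx (R : realType) m p (A : 'M[R]_(m, p)) u v :
  dotv u (A *m v) = dotv (A^T *m u) v.
Proof.
have dE k (f g : 'cV[R]_k) : dotv f g = (f^T *m g) 0 0.
  by rewrite mxE; apply: eq_bigr => i _; rewrite mxE.
by rewrite !dE trmx_mul trmxK mulmxA.
Qed.

(** For nonzero norms, expand the sum of squares of the entries of [norm2 v *: u - norm2 u *: v] and
    divide by the product of the norms. *)
Lemma dotv_le_norm2 (R : realType) m (u v : 'cV[R]_m) :
  dotv u v <= norm2 u * norm2 v.
Proof.
have u0 : 0 <= norm2 u := sqrtr_ge0 _; have v0 : 0 <= norm2 v := sqrtr_ge0 _.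
have dv0 (f g : 'cV[R]_m) : norm2 f = 0 -> dotv f g = 0.
  move=> f0; have /eqP : dotv f f = 0 by rewrite -sqr_norm2 f0 expr0n.
  rewrite psumr_eq0 => [/allP H|i _]; last by rewrite -expr2 sqr_ge0.
  rewrite /dotv big1 // => i _; have /eqP := H i (mem_index_enum i).
  by move/eqP; rewrite mulf_eq0 orbb => /eqP ->; rewrite mul0r.
have [un0|un0] := eqVneq (norm2 u) 0; first by rewrite dv0 ?un0 ?mul0r.
have [vn0|vn0] := eqVneq (norm2 v) 0.
  by rewrite dotvC dv0 ?vn0 ?mulr0.
have uv0 : 0 < norm2 u * norm2 v by rewrite mulr_gt0 // lt0r ?un0 ?vn0.
have : 0 <= \sum_i (norm2 v * u i 0 - norm2 u * v i 0) ^+ 2.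
  by apply: sumr_ge0 => i _; rewrite sqr_ge0.
have -> : \sum_i (norm2 v * u i 0 - norm2 u * v i 0) ^+ 2 =
    norm2 v ^+ 2 * dotv u u + norm2 u ^+ 2 * dotv v v
    - 2 * (norm2 u * norm2 v) * dotv u v.
  rewrite /dotv !mulr_sumr -sumrN -!big_split /=; apply: eq_bigr => i _; ring.
rewrite -!sqr_norm2 => H; rewrite -(ler_pM2l uv0); nra.
Qed.

Lemma norm2_abs (R : realType) m (v : 'cV[R]_m) :
  norm2 (map_mx Num.norm v) = norm2 v.
Proof.
congr Num.sqrt; apply: eq_bigr => i _.
by rewrite mxE -!expr2 real_normK ?num_real.
Qed.

(** The absolute values stay inside the sum because the lower bound treats terms of either sign
    separately. *)
Lemma sum_abs_le_norm2 (R : realType) m (u v : 'cV[R]_m) :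
  \sum_i `|u i 0 * v i 0| <= norm2 u * norm2 v.
Proof.
rewrite -(norm2_abs u) -(norm2_abs v); apply: le_trans (dotv_le_norm2 _ _).
by apply: ler_sum => i _; rewrite !mxE normrM.
Qed.

(** * Scalar bounds for x log x and for positive parts *)

(** Here [w] stands for log x. Multiply the tangent bound exp(-w-1) >= -w by exp(w). *)
Lemma expR_entropy_ge (R : realType) (w : R) : - (w * expR w) <= (expR 1)^-1.
Proof.
rewrite -expRN; have := expR_ge1Dx (- w - 1); rewrite expRD => H.
have := expRxMexpNx_1 w; have := expR_gt0 w; have := expR_gt0 (- 1 : R).
set p := expR w in H *; set q := expR (-w) in H *; set k := expR (-1) in H *.
move=> k0 p0 pq; have : - w * p <= q * k * p by rewrite ler_pM2r //; lra.
by rewrite mulrAC (mulrC q) pq mul1r mulNr.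
Qed.

(** Only w > 0 is delicate. With p = exp(w) and k = 1/e the claim is (2-p)w <= k. This is clear for
    p > 2; otherwise the tangent bound w <= pk leaves (2-p)p <= 1, that is (p-1)^2 >= 0. *)
Lemma expR_entropy_le (R : realType) (w : R) :
  w * expR w
    <= (expR 1)^-1 + 2 * (Num.max 0 (expR w - 1) * Num.max 0 w).
Proof.
rewrite -expRN; have := expR_gt0 (- 1 : R); have := expR_gt0 w.
have := expR_ge1Dx (w - 1); rewrite expRD.
have [w0|w0] := leP w 0; last first.
  rewrite max_r; last by rewrite subr_ge0 ltW // expR_gt1.
  have := expR_ge1Dx w.
  set p := expR w; set k := expR (-1) => pw wpk p0 k0.
  have w1 : w <= p * k by lra.
  have : p * w <= p * (p * k) by rewrite ler_pM2l.
  have [p2|p2] := leP p 2; last first.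
    have : 0 <= (p - 2) * w by apply: mulr_ge0; lra.
    lra.
  have : (2 - p) * w <= (2 - p) * (p * k) by apply: ler_wpM2l; lra.
  have : 0 <= (p - 1) ^+ 2 * k by rewrite mulr_ge0 ?sqr_ge0 // ltW.
  lra.
rewrite !mulr0 addr0; set p := expR w => _ p0 k0.
have : w * p <= 0 by rewrite pmulr_lle0 ?expR_gt0.
lra.
Qed.

(** If some term exceeds 1, it absorbs the single subtraction of 1 on the right, and every other
    excess is at most the term itself. *)
Lemma sum_excess_le (R : realType) (I : finType) (f : I -> R) :
  (forall i, 0 <= f i) ->
  \sum_i Num.max 0 (f i - 1) <= Num.max 0 (\sum_i f i - 1).
Proof.
move=> f0; case: (pickP (fun i => 1 < f i)) => [i fi|f1]; last first.
  rewrite big1 ?le_max ?lexx // => i _.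
  by apply: max_l; rewrite subr_le0 leNgt f1.
rewrite le_max; apply/orP; right.
rewrite (bigD1 i) //= [X in _ <= X - 1](bigD1 i) //=.
rewrite max_r; last by rewrite subr_ge0 ltW.
rewrite [leRHS]addrAC lerD2l; apply: ler_sum => j _.
by rewrite ge_max f0 gerBl ler01.
Qed.

Lemma mul_excess_le (R : realType) (r a : R) :
  Num.max 0 r * Num.max 0 a <= Num.max 0 (r * a).
Proof.
by rewrite !le_max; case: (leP 0 r) => r0; case: (leP 0 a) => a0;
  rewrite ?mul0r ?mulr0 ?lexx ?orbT.
Qed.

Lemma opp_excess (R : realType) (z : R) : - z = `|z| - 2 * Num.max 0 z.
Proof.
by case: (leP 0 z) => z0; [rewrite ger0_norm|rewrite ltr0_norm] => //; lra.
Qed.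

Lemma mulr_invM_gt0 (R : realType) (k t : R) : 0 < t -> t * (k * t)^-1 = k^-1.
Proof. by move=> t0; rewrite invfM mulrCA mulfV ?gt_eqF // mulr1. Qed.

(** * Entropy sums over the support *)

(** On [Sigma] the factor [a i + b j - C i j] is log(X i j)/t, so the left side is the scaled
    entropy; surpluses of large entries are charged to their row and column sums. *)
Lemma entropy_le_excess (R : realType) (n : nat) (Sigma : {set 'I_n * 'I_n})
    (t : R) (C X : 'M[R]_n) (a b : 'I_n -> R) :
  0 < t -> (forall i j, 0 <= C i j) ->
  (forall i j,
    X i j = ((i, j) \in Sigma)%:R * expR (t * (a i + b j - C i j))) ->
  \sum_i \sum_j X i j * (a i + b j - C i j)
    <= (expR 1 * t)^-1 * #|Sigma|%:R
       + 2 * (\sum_i Num.max 0 ((\sum_j X i j - 1) * a i)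
              + \sum_j Num.max 0 ((\sum_i X i j - 1) * b j)).
Proof.
move=> t0 C0 XE.
have X0 i j : 0 <= X i j by rewrite XE mulr_ge0 ?ler0n ?expR_ge0.
have m0 (z : R) : 0 <= Num.max 0 z by rewrite le_max lexx.
have entry i j : X i j * (a i + b j - C i j) <=
    (expR 1 * t)^-1 * ((i, j) \in Sigma)%:R +
    2 * (Num.max 0 (X i j - 1) * Num.max 0 (a i) +
         Num.max 0 (X i j - 1) * Num.max 0 (b j)).
  rewrite XE; case: ((i, j) \in Sigma); rewrite ?mul0r ?mulr0 ?add0r; last first.
    by rewrite mulr_ge0 ?addr_ge0 ?mulr_ge0.
  rewrite mul1r mulr1 -mulrDr -(ler_pM2l t0).
  have := expR_entropy_le (t * (a i + b j - C i j)).
  have [w wE] : {w | w = a i + b j - C i j} by exists (a i + b j - C i j).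
  rewrite -wE; set p := expR _ => H.
  have -> : t * (p * w) = t * w * p by ring.
  apply: le_trans H _; rewrite [leRHS]mulrDr mulr_invM_gt0 // lerD2l.
  rewrite [leRHS]mulrCA ler_pM2l // mulrCA; apply: ler_wpM2l => //.
  rewrite ge_max mulr_ge0 ?addr_ge0 ?(ltW t0) //= ler_pM2l // wE.
  (* Nonnegativity of the cost allows [C i j] to be dropped. *)
  apply: le_trans (lerD (_ : a i <= _) (_ : b j <= _)).
  - by rewrite gerBl.
  - by rewrite le_max lexx orbT.
  - by rewrite le_max lexx orbT.
apply: (@le_trans _ _ (\sum_i \sum_j ((expR 1 * t)^-1 * ((i, j) \in Sigma)%:R +
    2 * (Num.max 0 (X i j - 1) * Num.max 0 (a i) +
         Num.max 0 (X i j - 1) * Num.max 0 (b j))))).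
  by apply: ler_sum => i _; apply: ler_sum => j _; exact: entry.
rewrite pair_bigA big_split /= -!mulr_sumr; apply: lerD.
  rewrite (eq_bigr (fun p => (p \in Sigma)%:R)) => [|[i j]//].
  by rewrite -natr_sum -sum1_card -big_mkcond.
rewrite ler_pM2l //.
rewrite -(pair_bigA _ (fun i j => Num.max 0 (X i j - 1) * Num.max 0 (a i) +
         Num.max 0 (X i j - 1) * Num.max 0 (b j))) /=.
under eq_bigr do rewrite big_split /=.
(* The [a] terms are grouped by rows and the [b] terms by columns, so that the second factor is
   constant in each inner sum. *)
rewrite big_split /=; apply: lerD; last rewrite exchange_big /=.
  apply: ler_sum => i _; apply: le_trans (mul_excess_le _ _).
  by rewrite -mulr_suml ler_wpM2r ?sum_excess_le.
apply: ler_sum => j _; apply: le_trans (mul_excess_le _ _).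
by rewrite -mulr_suml ler_wpM2r ?sum_excess_le.
Qed.

Lemma entropy_ge (R : realType) (n : nat) (Sigma : {set 'I_n * 'I_n})
    (t : R) (X : 'M[R]_n) (V : 'I_n -> 'I_n -> R) :
  0 < t ->
  (forall i j, X i j = ((i, j) \in Sigma)%:R * expR (t * V i j)) ->
  - (\sum_i \sum_j X i j * V i j)
    <= (expR 1 * t)^-1 * #|Sigma|%:R.
Proof.
move=> t0 XE; rewrite pair_bigA /= -sumrN -sum1_card natr_sum mulr_sumr.
rewrite [leRHS]big_mkcond /=; apply: ler_sum => -[i j] _ /=.
rewrite XE; case: ((i, j) \in Sigma); rewrite ?mul0r ?oppr0 //.
rewrite mul1r mulr1 -(ler_pM2l t0).
rewrite mulr_invM_gt0 //.
by apply: le_trans (expR_entropy_ge (t * V i j)); rewrite mulrN mulrCA mulrC.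
Qed.

(** * Reshaping, the adjoint of the marginals, and total support *)

Lemma dotv_unreshape_mx (R : realType) n (A B : 'M[R]_n) :
  dotv (unreshape_mx A) (unreshape_mx B) = \sum_i \sum_j A i j * B i j.
Proof.
rewrite pair_bigA /dotv (reindex _ (curry_mxvec_bij _ _)) /=.
by apply: eq_bigr => -[i j] _; rewrite !mxE !mxvecE.
Qed.

Lemma marginal_tr_mxE (R : realType) n (v : 'cV[R]_(n + n)) i j :
  ((marginal_mx R n)^T *m v) (mxvec_index i j) 0
  = usubmx v i 0 + dsubmx v j 0.
Proof.
rewrite -{1}(vsubmxK v).
have := reshape_tr_marginal_mx (usubmx v) (dsubmx v).
move/matrixP/(_ i j); rewrite /reshape_mx mxE [LHS]mxE => ->.
by rewrite mxE !mxE !big_ord1 !mxE mulr1 mul1r.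
Qed.

Lemma null_space_marginalP (R : realType) n (Sigma : {set 'I_n * 'I_n})
    (v : 'cV[R]_(n + n)) :
  in_null_space (diag_mx (unreshape_mx (indicator_mx R Sigma))^T
                 *m (marginal_mx R n)^T) v ->
  forall i j, (i, j) \in Sigma -> usubmx v i 0 + dsubmx v j 0 = 0.
Proof.
rewrite /in_null_space -mulmxA => /matrixP H i j ij.
have := H (mxvec_index i j) 0.
by rewrite mul_diag_mx mxE marginal_tr_mxE trmxK mxvecE !mxE ij mul1r.
Qed.

Lemma dotv_ones_split (R : realType) n (v : 'cV[R]_(n + n)) :
  dotv (ones R (n + n)) v = \sum_i (usubmx v i 0 + dsubmx v i 0).
Proof.
rewrite /dotv big_split_ord big_split /=.
by congr (_ + _); apply: eq_bigr => i _; rewrite !mxE mul1r.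
Qed.

(** Total support yields a permutation whose diagonal lies in [Sigma]. Summing the relations along
    it meets every row and every column exactly once. *)
Lemma total_support_ones_orth (R : realType) n (Sigma : {set 'I_n * 'I_n})
    (v : 'cV[R]_(n + n)) :
  total_support_condition R Sigma ->
  (forall i j, (i, j) \in Sigma -> usubmx v i 0 + dsubmx v j 0 = 0) ->
  dotv (ones R (n + n)) v = 0.
Proof.
case=> _ /matrix0Pn[i [j]] Xij /(_ i j); rewrite lt0r Xij !mxE ler0n.
case=> // s [_ sS] vS; rewrite dotv_ones_split big_split /=.
rewrite [X in _ + X](reindex_inj (@perm_inj _ s)) -big_split big1 //= => k _.
by apply: vS; have := sS k; rewrite mxE; case: (_ \in _); rewrite ?ltxx.
Qed.

(** * The duality gap *)

Theorem theorem2 (R : realType) (n d : nat) (y z : 'I_n -> 'cV[R]_d)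
    (t delta eps_MB : R) (Sigma : {set 'I_n * 'I_n}) (nu : 'cV[R]_(n + n))
    (x : 'cV[R]_(n * n)) (P : 'M[R]_(n + n)) :
  let M := marginal_mx R n in
  let c := cost_vector y z in
  let s := unreshape_mx (indicator_mx R Sigma) in
  (1 <= n)%N ->
  0 < t ->
  total_support_condition R Sigma ->
  x = hadamard s (map_mx expR (- t *: (c - M^T *m nu))) ->
  orthogonal_projection_with_kernel P (in_null_space (diag_mx s^T *m M^T)) ->
  0 < delta ->
  norm2 (P *m nu) <= delta ->
  0 < eps_MB ->
  norm2 (M *m x - ones R (n + n)) <= eps_MB ->
  `|dotv c x - dotv (ones R (n + n)) nu|
    <= eps_MB * delta + (expR 1 * t)^-1 * #|Sigma|%:R.
Proof.
move=> M c s _ t0 tsS xE [PP _ kerP] delta0 nu_le eps0 Mx_le.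
set mu := P *m nu in nu_le.
have nuS : forall i j, (i, j) \in Sigma ->
    usubmx (nu - mu) i 0 + dsubmx (nu - mu) j 0 = 0.
  (* Idempotence of [P] puts [nu - mu] in its kernel. *)
  apply: null_space_marginalP; apply/kerP.
  by rewrite /in_null_space mulmxBr mulmxA PP subrr.
have onesE : dotv (ones R (n + n)) nu = dotv (ones R (n + n)) mu.
  by apply: subr0_eq; rewrite -dotvB (total_support_ones_orth tsS nuS).
pose a i := usubmx mu i 0; pose b j := dsubmx mu j 0.
pose C : 'M[R]_n := \matrix_(i, j) norm2 (y i - z j) ^+ 2.
pose X : 'M[R]_n := \matrix_(i, j)
  (((i, j) \in Sigma)%:R * expR (t * (a i + b j - C i j))).
(* On [Sigma] the exponent sees [nu] only through its row-plus-column sums, which agree with those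
   of [mu]; off [Sigma] both sides vanish. *)
have {}xE : x = unreshape_mx X.
  apply/colP => k; rewrite xE; case/mxvec_indexP: k => i j.
  rewrite /hadamard !mxE !mxvecE !mxE.
  have [ij|] := boolP ((i, j) \in Sigma); last by rewrite !mul0r.
  have := marginal_tr_mxE nu i j; rewrite mxE => ->.
  rewrite mulNr -mulrN; congr (_ * expR (t * _)).
  have := nuS i j ij; rewrite /a /b !mxE; lra.
pose r : 'cV[R]_(n + n) := M *m x - ones R (n + n).
have rE : r = marginals x - ones R (n + n) by rewrite -marginal_mxE.
have ruE i : r (lshift n i) 0 = \sum_j X i j - 1.
  rewrite rE /marginals xE unreshape_mxK mxE col_mxEu !mxE; congr (_ - _).
  by apply: eq_bigr => j _; rewrite [X in _ * X]mxE mulr1.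
have rdE j : r (rshift n j) 0 = \sum_i X i j - 1.
  rewrite rE /marginals xE unreshape_mxK mxE col_mxEd !mxE; congr (_ - _).
  by apply: eq_bigr => i _; rewrite !mxE mulr1.
have gapE : dotv c x - dotv (ones R (n + n)) nu =
    dotv mu r - \sum_i \sum_j X i j * (a i + b j - C i j).
  have -> : dotv mu r = dotv (M^T *m mu) x - dotv (ones R (n + n)) mu.
    by rewrite dotvB dotv_mulmx (dotvC mu (ones _ _)).
  have -> : dotv (M^T *m mu) x = \sum_i \sum_j (a i + b j) * X i j.
    rewrite xE -[M^T *m mu]reshape_mxK dotv_unreshape_mx.
    apply: eq_bigr => i _; apply: eq_bigr => j _; congr (_ * _).
    by rewrite /reshape_mx mxE [LHS]mxE marginal_tr_mxE.
  rewrite onesE addrAC; congr (_ - _); rewrite xE dotv_unreshape_mx -sumrB.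
  apply: eq_bigr => i _; rewrite -sumrB; apply: eq_bigr => j _; ring.
have XE i j : X i j = ((i, j) \in Sigma)%:R * expR (t * (a i + b j - C i j)).
  by rewrite mxE.
have mu_r : \sum_k `|mu k 0 * r k 0| <= eps_MB * delta.
  apply: le_trans (sum_abs_le_norm2 _ _) _.
  by rewrite mulrC ler_pM ?sqrtr_ge0.
have entr_ge := entropy_ge t0 XE.
have C0 i j : 0 <= C i j by rewrite mxE sqr_ge0.
have := entropy_le_excess t0 C0 XE.
(* Row and column surpluses are the upper and lower halves of [r]. *)
have -> : \sum_i Num.max 0 ((\sum_j X i j - 1) * a i) +
    \sum_j Num.max 0 ((\sum_i X i j - 1) * b j) =
    \sum_k Num.max 0 (mu k 0 * r k 0).
  rewrite [RHS]big_split_ord /=; congr (_ + _); apply: eq_bigr => k _.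
    by rewrite ruE mulrC /a mxE.
  by rewrite rdE mulrC /b mxE.
have : - dotv mu r =
    \sum_k `|mu k 0 * r k 0| - 2 * \sum_k Num.max 0 (mu k 0 * r k 0).
  rewrite /dotv -sumrN mulr_sumr -sumrB.
  by apply: eq_bigr => k _; rewrite opp_excess.
have : dotv mu r <= \sum_k `|mu k 0 * r k 0|.
  by apply: ler_sum => k _; exact: ler_norm.
(* In the lower bound the two multiples of the sum of positive parts cancel. *)
rewrite gapE ler_norml; lra.
Qed.
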